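(* Fix any $\epsilon>0$ and $\beta\in(0,\tfrac12)$. Consider the following algorithm on input a weighted graph $G=(V,E,w)$ on $n$ vertices with $w\in\mathbb{R}_+^N$ and $m=|E|$: (1) set $\widehat m\leftarrow\min\{N,\lceil m+Z_0+\log(1/\beta)/\epsilon\rceil\}$ with $Z_0\sim\mathrm{Lap}(1/\epsilon)$; (2) sample $\widehat E\subseteq[N]$ with $|\widehat E|=\widehat m$ from the distribution $\pi(S)\propto\prod_{e\in S}\exp(\epsilon w_e)$ over subsets $S\subseteq[N]$ of size $\widehat m$; (3) for each $e\in\widehat E$ draw an independent $Z_e\sim\mathrm{Lap}(1/\epsilon)$ and set $\widehat w_e\leftarrow\max\{0,w_e+Z_e\}$, and set $\widehat w_e\leftarrow 0$ for $e\notin\widehat E$; (4) output $\widehat G=(V,\widehat E,\widehat w)$. Then for any input graph $G$ with maximum unweighted degree $\Delta(G)\le n-1$ and with $m=\Omega(n)$ and $m=o(N)$, and for any positive constant $c$, with probability at least $1-2\beta-1/n^c$ the output satisfies $$\|L_G-L_{\widehat G}\|_2=O\!\left(\frac{\Delta(G)\log^2 n}{\epsilon}+\frac{\log(1/\beta)\log^2 n}{n\epsilon^2}\right).$$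
   Context: $N=\binom n2$ and unordered pairs of distinct vertices are identified with $[N]$; a weighted graph is identified with $w\in\mathbb{R}_+^N$, $E=\{e:w_e\ne0\}$. $\Delta(G)$ is the maximum number of edges of $E$ incident to a single vertex. $\mathrm{Lap}(b)$ has density $\frac{1}{2b}e^{-|x|/b}$. The Laplacian is $L_G=D_G-A_G$, where $A_G$ is the weighted adjacency matrix and $D_G$ the diagonal matrix of weighted degrees; $\|\cdot\|_2$ is the spectral norm. Asymptotic notation is as $n\to\infty$. *)

(* Defs.v *)
From HB Require Import structures.
From mathcomp Require Import all_boot all_order all_algebra.
From mathcomp Require Import all_classical all_reals all_analysis.

Set Implicit Arguments.
Unset Strict Implicit.
Unset Printing Implicit Defensive.

Import Order.TTheory GRing.Theory Num.Theory.
Import numFieldNormedType.Exports.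

Local Open Scope classical_set_scope.
Local Open Scope ring_scope.

Definition vpair (n : nat) := {e : {set 'I_n} | #|e| == 2%N}.

Record wgraph (R : realType) (n : nat) := WGraph {
  weight :> vpair n -> R;
  weight_ge0 : forall e, 0 <= weight e
}.

Section graph.
Variables (R : realType) (n : nat).
Implicit Types G : wgraph R n.

Definition edges G : {set vpair n} := [set e | G e != 0]%SET.

Definition maxdeg G : nat :=
  \max_(v : 'I_n) #|[set e in edges G | v \in val e]%SET|.

(* [insub] fails on the diagonal, where [set i; i] is a singleton. *)
Definition adjacency G : 'M[R]_n :=
  \matrix_(i, j) oapp (weight G) 0 (insub [set i; j]%SET).

Definition degree_mx G : 'M[R]_n :=
  diag_mx (\row_i \sum_j adjacency G i j).

Definition laplacian G : 'M[R]_n := degree_mx G - adjacency G.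

End graph.

Definition l2norm (R : realType) (n : nat) (x : 'cV[R]_n) : R :=
  Num.sqrt (\sum_i x i 0 ^+ 2).

Definition spectral_norm (R : realType) (n : nat) (M : 'M[R]_n) : R :=
  sup [set l2norm (M *m x) | x in [set x : 'cV[R]_n | l2norm x <= 1]].

Definition laplace_pdf (R : realType) (b x : R) : R :=
  (2 * b)^-1 * expR (- (`|x| / b)).

Definition laplace_prob (R : realType) (b : R) (A : set R) : \bar R :=
  (\int[lebesgue_measure]_(x in A) (laplace_pdf b x)%:E)%E.

Section algorithm.
Variables (R : realType) (n : nat) (eps beta : R) (G : wgraph R n).

Definition mhat (z : R) : int :=
  Num.min ('C(n, 2))%:Z (Num.ceil (#|edges G|%:R + z + ln (1 / beta) / eps)).

Definition subset_weight (S : {set vpair n}) : R :=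
  \prod_(e in S) expR (eps * G e).

Definition subset_pmf (k : nat) (S : {set vpair n}) : R :=
  if #|S| == k then
    subset_weight S / \sum_(S' : {set vpair n} | #|S'| == k) subset_weight S'
  else 0.

(* One execution of the algorithm on a probability space: [run_law] says that,
   given [Z0] with [mhat Z0 = k >= 0], the set [Ehat] has law [subset_pmf k]
   and, given moreover [Ehat = S], the [Z e] for [e] in [S] are independent
   with Laplace law. Nothing is assumed on [Ehat] and [Z] (beyond
   measurability) when [mhat Z0 < 0], where no subset of size [mhat Z0] exists,
   nor on [Z e] when [e] is not in [Ehat]. *)
Record run (d : measure_display) (T : measurableType d)
    (P : probability T R) := Run {
  Z0 : {RV P >-> R};
  Ehat : T -> {set vpair n};
  Z : vpair n -> {RV P >-> R};
  Z0_law : forall B : set R, measurable B ->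
    P (Z0 @^-1` B) = laplace_prob (1 / eps) B;
  Ehat_measurable : forall S, measurable (Ehat @^-1` [set S]);
  run_law : forall (k : nat) (S : {set vpair n})
      (B0 : set R) (B : vpair n -> set R),
    measurable B0 -> (forall e, measurable (B e)) ->
    P [set t | [/\ B0 (Z0 t), mhat (Z0 t) = k%:Z, Ehat t = S &
                   forall e, e \in S -> B e (Z e t)]] =
    (laplace_prob (1 / eps) (B0 `&` [set z | mhat z = k%:Z]) *
     (subset_pmf k S)%:E *
     \prod_(e in S) laplace_prob (1 / eps) (B e))%E
}.

Section output.
Variables (d : measure_display) (T : measurableType d) (P : probability T R).
Variable X : run P.

Definition what (t : T) (e : vpair n) : R :=
  if e \in Ehat X t then Num.max 0 (G e + Z X e t) else 0.

Lemma what_ge0 (t : T) (e : vpair n) : 0 <= what t e.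
Proof. by rewrite /what; case: ifP => // _; rewrite le_max lexx. Qed.

Definition output (t : T) : wgraph R n := WGraph (what_ge0 t).

End output.
End algorithm.

(* Main.v *)
Require Import Defs.
From mathcomp Require Import all_boot all_order all_algebra all_fingroup.
From mathcomp Require Import all_classical all_reals all_analysis.
From mathcomp Require Import measurable_realfun ring lra zify.
Set Implicit Arguments.
Unset Strict Implicit.
Unset Printing Implicit Defensive.
Import Order.TTheory GRing.Theory Num.Theory.
Import numFieldNormedType.Exports.
Local Open Scope classical_set_scope.
Local Open Scope ring_scope.

(* Put [K := c + 5], [s := K ln n / eps] and [l := ln (1 / beta) / eps].
   With probability [1 - beta] the noise [Z0] lies in [[-l, l]], and then
   [m <= mhat <= m + 2 l + 1]. Given [mhat = k]:
   - an edge [e] of weight [> s] is missed with probability at most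
     [N exp (- eps s)], since a [k]-set missing [e] contains a non-edge, and
     exchanging it for [e] multiplies the weight by [exp (eps w_e)];
   - the non-edges are exchangeable, so a given set [F] of them is sampled with
     probability at most [(k / (N - m))^#|F|]; hence the number [X] of sampled
     non-edges at a vertex satisfies [E 2^X <= exp (n k / (N - m))], so that
     [X = O(Delta + l / n + ln n)] at every vertex with high probability;
   - all the sampled [Z e] lie in [[-s, s]] with probability
     [>= 1 - N exp (- eps s)].
   On this event every pair has error at most [s], and the pairs with non-zero
   error are edges of [G] or sampled non-edges. The spectral norm of the
   difference of the Laplacians is at most twice the maximal sum of the errors
   at a vertex (Schur's test), i.e. [O(s (Delta + l / n + ln n))]. *)

(** * Subsets of a fixed size under a product weight *)

Section product_weighted_subsets.
Variables (R : realFieldType) (T : finType) (a : T -> R).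
Hypothesis a_ge0 : forall e, 0 <= a e.

Definition prod_weight (S : {set T}) : R := \prod_(e in S) a e.
Let wt := prod_weight.

Lemma prod_weight_ge0 S : 0 <= wt S.
Proof. by apply: prodr_ge0. Qed.
Local Hint Resolve prod_weight_ge0 : core.

Let swap (f g : T) (S : {set T}) : {set T} := tperm f g @: S.

Let swap_inj f g : injective (swap f g).
Proof. by apply: imset_inj; exact: perm_inj. Qed.

Let card_swap f g S : #|swap f g S| = #|S|.
Proof. by rewrite card_imset//; exact: perm_inj. Qed.

Let weight_swap f g S : wt (swap f g S) = \prod_(e in S) a (tperm f g e).
Proof. by rewrite /wt/prod_weight big_imset//= => x y _ _; exact: perm_inj. Qed.

(* Exchanging [e] for some element [g] of [S] outside [E] multiplies the weight
   by [a e]; for each [g] the exchange is injective. *)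
Lemma weight_avoiding_le (E : {set T}) (k : nat) (e : T) :
    (forall g, g \notin E -> a g = 1) -> e \in E -> (#|E| <= k)%N ->
  a e * \sum_(S : {set T} | (#|S| == k) && (e \notin S)) wt S <=
  #|T|%:R * \sum_(S : {set T} | #|S| == k) wt S.
Proof.
move=> a1 eE Ek.
have step (S : {set T}) : #|S| == k -> e \notin S ->
    a e * wt S <= \sum_(g in S :\: E) wt (swap e g S).
  move=> /eqP Sk eS.
  have Ewt g : g \in S :\: E -> wt (swap e g S) = a e * wt S.
    rewrite inE => /andP[gE gS].
    rewrite weight_swap /wt /prod_weight (bigD1 g)//= [in RHS](bigD1 g)//=.
    rewrite tpermR (a1 _ gE) mul1r; congr (_ * _); apply: eq_bigr => x /andP[xS xg].
    by rewrite tpermD// eq_sym//; apply: contraNneq eS => <-.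
  rewrite (eq_bigr _ Ewt) sumr_const.
  (* All summands equal [a e * wt S], so one [g] suffices. It exists because a set with at least
     [#|E|] elements that omits [e] from [E] cannot lie inside [E]. *)
  suff: (0 < #|S :\: E|)%N.
    by case: #|_| => // j _; rewrite mulrS lerDl mulrn_wge0// mulr_ge0.
  rewrite card_gt0; apply/negP => /eqP SE.
  have sSE : S \subset E by rewrite -finset.setD_eq0 SE.
  have : S \proper E by apply/properP; split => //; exists e.
  by move/proper_card; rewrite Sk ltnNge Ek.
rewrite mulr_sumr.
apply: (@le_trans _ _ (\sum_(S : {set T} | #|S| == k) \sum_(g : T) wt (swap e g S))).
  rewrite big_mkcondr/=; apply: ler_sum => S Sk; case: ifPn => [eS|_].
    apply: le_trans (step _ Sk eS) _.
    by rewrite big_mkcond/=; apply: ler_sum => g _; case: ifP.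
  by apply: sumr_ge0.
rewrite exchange_big/= -sum1_card natr_sum mulr_suml; apply: ler_sum => g _.
rewrite mul1r [leRHS](reindex_inj (@swap_inj e g)).
by under [leRHS]eq_bigl do rewrite card_swap.
Qed.

Section exchangeable.
Variables (U : {set T}) (k : nat).
Hypothesis aU : {in U &, forall f g, a f = a g}.

Let W (F : {set T}) : R := \sum_(S : {set T} | (#|S| == k) && (F \subset S)) wt S.

Let W_ge0 F : 0 <= W F. Proof. by apply: sumr_ge0. Qed.

(** The transposition of [f] and [g] is a bijection between the two families of [k]-sets, and it
    preserves weights because [a] is constant on [U]. *)
Let W_swap (F : {set T}) f g : f \in U -> g \in U -> f \notin F -> g \notin F ->
  W (f |: F) = W (g |: F).
Proof.
move=> fU gU fF gF; rewrite /W (reindex_inj (@swap_inj f g)).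
apply: eq_big => [S|S _].
  rewrite card_swap; congr (_ && _).
  have -> : f |: F = swap f g (g |: F).
    rewrite /swap imsetU1 tpermR; congr (_ |: _).
    rewrite -[LHS]imset_id; apply: eq_in_imset => x xF; rewrite tpermD//.
      by apply: contraNneq fF => ->.
    by apply: contraNneq gF => ->.
  apply/idP/idP; last exact: imsetS.
  move=> /fintype.subsetP H; apply/fintype.subsetP => x xF.
  have /imsetP[y yS /perm_inj-> //] := H _ (imset_f (tperm f g) xF).
rewrite weight_swap; apply: eq_bigr => x _.
by case: tpermP => // ->; apply: aU.
Qed.

(** Double counting over [g] in [U]. Outside [F], [W (g |: F)] equals [W (f |: F)] by
    exchangeability; inside [F] it is [W F], which is at least as large. Each [k]-set [S] containing
    [F] is counted [#|S :&: U|] times, at most [k]. *)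
Let W_setU1_le (F : {set T}) f : F \subset U -> f \in U -> f \notin F ->
  #|U|%:R * W (f |: F) <= k%:R * W F.
Proof.
move=> FU fU fF.
apply: (@le_trans _ _ (\sum_(g in U) W (g |: F))).
  rewrite -sum1_card natr_sum mulr_suml; apply: ler_sum => g gU; rewrite mul1r.
  have [gF|gF] := boolP (g \in F); last by rewrite (W_swap fU gU).
  have -> : g |: F = F by apply/finset.setUidPr; rewrite finset.sub1set.
  rewrite /W big_mkcondr/= [leRHS]big_mkcondr/=; apply: ler_sum => S _.
  case: ifPn => [|_]; last by case: ifP.
  by rewrite finset.subUset => /andP[_ ->].
rewrite /W; under eq_bigr => g _ do rewrite big_mkcond/=.
rewrite exchange_big/= mulr_sumr [leRHS]big_mkcond/=; apply: ler_sum => S _.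
case: ifPn => [/andP[Sk FS]|H]; last first.
  rewrite big1// => g _; rewrite ifF//; apply/negP => /andP[Sk].
  by rewrite finset.subUset => /andP[_ FS]; rewrite Sk FS in H.
rewrite Sk/=; under eq_bigr => g _ do rewrite finset.subUset FS andbT finset.sub1set.
rewrite -big_mkcondr/= sumr_const -[leLHS]mulr_natl ler_wpM2r// ler_nat.
rewrite -(eqP Sk); apply: subset_leq_card; apply/fintype.subsetP => x.
by case/andP.
Qed.

(** Each element of [F], added in turn, costs a factor [k / #|U|]; [W finset.set0] is the total
    weight. *)
Let W_le (F : {set T}) : F \subset U -> (0 < #|U|)%N ->
  W F <= (k%:R / #|U|%:R) ^+ #|F| * W finset.set0.
Proof.
move=> + U0; elim: {F}#|F| {-2}F (erefl #|F|) => [|j IH] F.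
  by move/eqP; rewrite cards_eq0 => /eqP-> _; rewrite cards0 expr0 mul1r.
move=> Fj FU; have /card_gt0P[f fF] : (0 < #|F|)%N by rewrite Fj.
have := Fj; rewrite (cardsD1 f) fF => -[F'j].
have sF' : F :\ f \subset U by exact: fintype.subset_trans (subD1set _ _) FU.
have := W_setU1_le sF' (fintype.subsetP FU _ fF); rewrite !inE eqxx => /(_ isT).
rewrite finset.setD1K// => H.
have U0' : 0 < #|U|%:R :> R by rewrite ltr0n.
rewrite exprS -mulrA -(ler_pM2l U0'); apply: le_trans H _.
have UK (Y : R) : #|U|%:R * (k%:R / #|U|%:R * Y) = k%:R * Y.
  by field; rewrite gt_eqF.
by rewrite UK ler_wpM2l//; exact: IH.
Qed.

Let sum_subset_expr (A : {set T}) (x : R) :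
  \sum_(F : {set T} | F \subset A) x ^+ #|F| = (1 + x) ^+ #|A|.
Proof.
transitivity (\prod_(i : T) ((if i \in A then x else 0) + 1)).
  rewrite bigA_distr big_mkcond/=; apply: eq_bigr => F _.
  rewrite -big_mkcond/=; case: ifPn => [/fintype.subsetP FA|/fintype.subsetPn[i iF iA]].
    rewrite -prodr_const; apply: eq_big => // i iF; by rewrite FA.
  by rewrite (bigD1 i)//= (negbTE iA) mul0r.
rewrite -prodr_const [RHS]big_mkcond/=; apply: eq_bigr => i _.
by case: ifP; rewrite ?add0r// addrC.
Qed.

(* A random [k]-subset meets [A] in a set of size [X] with
   [E 2^X <= (1 + k / #|U|)^#|A|]; the conclusion is Markov's inequality. *)
Lemma weight_large_meet_le (A : {set T}) (y : R) :
    A \subset U -> (0 < #|U|)%N ->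
  y * \sum_(S : {set T} | (#|S| == k) && (y <= 2 ^+ #|S :&: A|)) wt S <=
  (1 + k%:R / #|U|%:R) ^+ #|A| * \sum_(S : {set T} | #|S| == k) wt S.
Proof.
move=> AU U0.
have W0 : W finset.set0 = \sum_(S : {set T} | #|S| == k) wt S.
  by apply: eq_bigl => S; rewrite finset.sub0set andbT.
rewrite -W0 -sum_subset_expr mulr_suml.
apply: (@le_trans _ _ (\sum_(F : {set T} | F \subset A) W F)); last first.
  by apply: ler_sum => F FA; apply: W_le => //; exact: fintype.subset_trans FA AU.
rewrite /W; under [leRHS]eq_bigr do rewrite big_mkcondr/=.
rewrite exchange_big/= mulr_sumr big_mkcondr/=; apply: ler_sum => S _.
rewrite -big_mkcondr/=.
(* The sets [i] are the subsets of [S :&: A]. Counting them turns the bounds on joint inclusion into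
   a bound on the exponential moment. *)
have -> : \sum_(i : {set T} | (i \subset A) && (i \subset S)) wt S =
    2 ^+ #|S :&: A| * wt S.
  rewrite sumr_const -[LHS]mulr_natl -natrX -card_powerset.
  congr (_%:R * _); apply: eq_card => F.
  by rewrite !inE finset.subsetI andbC.
by case: ifP => [yS|_]; [exact: ler_wpM2r|rewrite mulr_ge0// exprn_ge0].
Qed.

End exchangeable.
End product_weighted_subsets.

(** * Schur's test and measurability for the spectral norm *)

Section spectral_norm.
Variables (R : realType) (n : nat).
Implicit Types (M : 'M[R]_n) (x : 'cV[R]_n) (b r : R).

Definition sqnorm x : R := \sum_i x i 0 ^+ 2.

Lemma sqnorm_ge0 x : 0 <= sqnorm x.
Proof. by apply: sumr_ge0 => i _; rewrite sqr_ge0. Qed.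
Local Hint Resolve sqnorm_ge0 : core.

Lemma l2norm_sqr x : l2norm x ^+ 2 = sqnorm x.
Proof. by rewrite /l2norm sqr_sqrtr//; exact: sqnorm_ge0. Qed.

Lemma l2norm_ge0 x : 0 <= l2norm x. Proof. exact: sqrtr_ge0. Qed.
Local Hint Resolve l2norm_ge0 : core.

Lemma l2normZ (a : R) x : l2norm (a *: x) = `|a| * l2norm x.
Proof.
rewrite /l2norm -sqrtr_sqr -sqrtrM ?sqr_ge0// mulr_sumr.
by congr Num.sqrt; apply: eq_bigr => i _; rewrite mxE exprMn.
Qed.

Lemma l2norm_eq0 x : l2norm x = 0 -> x = 0.
Proof.
move=> /eqP; rewrite sqrtr_eq0 => x0.
have /eqP : \sum_i x i 0 ^+ 2 = 0 by apply/le_anti/andP; split => //; exact: sqnorm_ge0.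
rewrite psumr_eq0 => [/allP H|i _]; last exact: sqr_ge0.
apply/colP => i; rewrite mxE; apply/eqP.
by have := H i (mem_index_enum _); rewrite sqrf_eq0.
Qed.

(** Cauchy-Schwarz with weights: twice the gap is the double sum of
    [p j * p k * (y j - y k) ^+ 2]. *)
Lemma sqr_weighted_sum_le (p y : 'I_n -> R) : (forall j, 0 <= p j) ->
  (\sum_j p j * y j) ^+ 2 <= (\sum_j p j) * \sum_j p j * y j ^+ 2.
Proof.
move=> p0; rewrite -(@ler_pM2l _ 2)// mulrDl mul1r [leRHS]mulrDl mul1r.
rewrite [X in _ <= _ + X]mulrC expr2 !big_distrlr/= -!big_split/=.
apply: ler_sum => j _; rewrite -!big_split/=; apply: ler_sum => k _.
have := mulr_ge0 (mulr_ge0 (p0 j) (p0 k)) (sqr_ge0 (y j - y k)).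
by nra.
Qed.

(* Schur's test *)
Lemma sqnorm_mulmx_le M r x : 0 <= r ->
    (forall i, \sum_j `|M i j| <= r) -> (forall j, \sum_i `|M i j| <= r) ->
  sqnorm (M *m x) <= r ^+ 2 * sqnorm x.
Proof.
move=> r0 Mr Mc.
have row_le i : (M *m x) i 0 ^+ 2 <= r * \sum_j `|M i j| * x j 0 ^+ 2.
  apply: (@le_trans _ _ ((\sum_j `|M i j| * `|x j 0|) ^+ 2)).
    have S0 : 0 <= \sum_j `|M i j| * `|x j 0|.
      by apply: sumr_ge0 => j _; rewrite mulr_ge0.
    rewrite -real_normK ?num_real// lerXn2r ?nnegrE//.
    rewrite mxE; apply: le_trans (ler_norm_sum _ _ _) _.
    by apply: ler_sum => j _; rewrite normrM.
  apply: le_trans (sqr_weighted_sum_le _ _) _ => //.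
  under [X in _ * X <= _]eq_bigr do rewrite real_normK ?num_real//.
  apply: ler_wpM2r (Mr i); apply: sumr_ge0 => j _.
  by rewrite mulr_ge0// sqr_ge0.
apply: le_trans (ler_sum _ (fun i _ => row_le i)) _.
(* The row sums have supplied one factor [r]; after the exchange of sums the column sums supply the
   other. *)
rewrite -mulr_sumr exchange_big/= expr2 -mulrA ler_wpM2l// mulr_sumr.
by apply: ler_sum => j _; rewrite -mulr_suml ler_wpM2r// sqr_ge0.
Qed.

Lemma l2norm_le_sqnorm b x y : 0 <= b -> sqnorm x <= b ^+ 2 * sqnorm y ->
  l2norm x <= b * l2norm y.
Proof.
move=> b0 xy; rewrite -(@ler_pXn2r _ 2) ?nnegrE ?mulr_ge0//.
by rewrite exprMn !l2norm_sqr.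
Qed.

Lemma spectral_norm_le_bound M b : 0 <= b ->
  (forall x, sqnorm (M *m x) <= b ^+ 2 * sqnorm x) -> spectral_norm M <= b.
Proof.
move=> b0 H; apply: ge_sup.
  exists (l2norm (M *m 0)); exists 0 => //=.
  by rewrite /l2norm big1 ?sqrtr0// => i _; rewrite mxE expr0n.
move=> _ [x /= x1 <-]; apply: le_trans (l2norm_le_sqnorm b0 (H x)) _.
by rewrite ler_piMr.
Qed.

Lemma spectral_norm_le_Schur M r : 0 <= r ->
    (forall i, \sum_j `|M i j| <= r) -> (forall j, \sum_i `|M i j| <= r) ->
  spectral_norm M <= r.
Proof.
by move=> r0 Mr Mc; apply: spectral_norm_le_bound => // x; exact: sqnorm_mulmx_le.
Qed.

Lemma l2norm_mulmx_le_spectral M x :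
  l2norm (M *m x) <= spectral_norm M * l2norm x.
Proof.
have [x0|x0] := eqVneq (l2norm x) 0.
  by rewrite x0 mulr0 (l2norm_eq0 x0) mulmx0 -(l2norm_eq0 x0) x0.
have x0' : 0 < l2norm x by rewrite lt_neqAle eq_sym x0/=.
have -> : M *m x = l2norm x *: (M *m ((l2norm x)^-1 *: x)).
  by rewrite scalemxAr scalerA divff// scale1r.
rewrite l2normZ ger0_norm// mulrC ler_wpM2r//.
apply: ub_le_sup; last first.
  by exists ((l2norm x)^-1 *: x) => //=; rewrite l2normZ ger0_norm ?invr_ge0// mulVf.
(* [sup] dominates its set only if the set is bounded above. The sum of all absolute entries
   dominates every row and column sum, so Schur's test gives a bound. *)
pose r := \sum_i \sum_j `|M i j|.
have sum0 i : 0 <= \sum_j `|M i j| by apply: sumr_ge0.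
have r0 : 0 <= r by apply: sumr_ge0.
exists r => _ [y /= y1 <-].
apply: (@le_trans _ _ (r * l2norm y)); last by rewrite ler_piMr.
apply: l2norm_le_sqnorm => //; apply: sqnorm_mulmx_le => // i.
  by rewrite /r [leRHS](bigD1 i)//= lerDl sumr_ge0.
rewrite /r exchange_big [leRHS](bigD1 i)//= lerDl sumr_ge0// => j _.
by apply: sumr_ge0.
Qed.

Lemma rat_vector_cvg x : exists u : nat -> 'cV[rat]_n,
  forall i, ratr (u k i 0) @[k --> \oo] --> x i 0.
Proof.
have H (k : nat) (i : 'I_n) : {q : rat | x i 0 < ratr q < x i 0 + k.+1%:R^-1}.
  apply: cid; have /rat_in_itvoo[q] : x i 0 < x i 0 + k.+1%:R^-1.
    by rewrite ltrDl invr_gt0.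
  by rewrite in_itv; exists q.
exists (fun k => \col_i sval (H k i)) => i.
apply: (@squeeze_cvgr _ _ _ _ (fun=> x i 0) (fun k => x i 0 + k.+1%:R^-1)).
- near=> k; rewrite mxE; case: (H k i) => q /= /andP[/ltW-> /ltW->]//.
- exact: cvg_cst.
- by rewrite -[X in _ --> X]addr0; apply: cvgD; [exact: cvg_cst|exact: cvg_harmonic].
Unshelve. all: by end_near. Qed.

(** Rational vectors are dense and both sides are continuous in the vector, so countably many tests
    suffice. This makes the error event measurable. *)
Lemma spectral_norm_le_rat M b : 0 <= b ->
  spectral_norm M <= b <->
  forall q : 'cV[rat]_n,
    sqnorm (M *m map_mx ratr q) <= b ^+ 2 * sqnorm (map_mx ratr q).
Proof.
move=> b0; split=> [Mb q|H].
  rewrite -!l2norm_sqr -exprMn lerXn2r ?nnegrE ?mulr_ge0//.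
  by apply: le_trans (l2norm_mulmx_le_spectral _ _) _; rewrite ler_wpM2r.
apply: spectral_norm_le_bound => // x.
have [u ux] := rat_vector_cvg x.
have sq_cvg (f : nat -> 'cV[R]_n) (y : 'cV[R]_n) :
    (forall i, f k i 0 @[k --> \oo] --> y i 0) ->
    sqnorm (f k) @[k --> \oo] --> sqnorm y.
  move=> fy; apply: cvg_big => [|i _]; first exact: add_continuous.
  by rewrite expr2; under eq_fun do rewrite expr2; apply: cvgM.
have ux' i : (map_mx ratr (u k) : 'cV[R]_n) i 0 @[k --> \oo] --> x i 0.
  by under eq_fun do rewrite mxE; exact: ux.
apply: (@ler_cvg_to _ \oo _ _ (fun k => sqnorm (M *m map_mx ratr (u k)))
  (fun k => b ^+ 2 * sqnorm (map_mx ratr (u k)))).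
- apply: (sq_cvg (fun k => M *m map_mx ratr (u k))) => i; rewrite mxE.
  under eq_fun do rewrite mxE.
  apply: cvg_big => [|j _]; first exact: add_continuous.
  by apply: cvgM => //; exact: cvg_cst.
- by apply: cvgM; [exact: cvg_cst|exact: (sq_cvg (fun k => map_mx ratr (u k)))].
- by near=> k; exact: H.
Unshelve. all: by end_near. Qed.

Lemma measurable_spectral_norm_le (d : measure_display) (T : measurableType d)
    (M : T -> 'M[R]_n) b : 0 <= b ->
    (forall i j, measurable_fun setT (fun t => M t i j)) ->
  measurable [set t | spectral_norm (M t) <= b].
Proof.
move=> b0 mM.
rewrite (_ : [set t | _] = ~` \bigcup_(q in [set: 'cV[rat]_n])
    ~` [set t | sqnorm (M t *m map_mx ratr q) <= b ^+ 2 * sqnorm (map_mx ratr q)]).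
  apply: measurableC; apply: countable_bigcupT_measurable => [|q].
    exact: countableP.
  apply: measurableC; rewrite -[X in measurable X]setTI.
  apply: measurable_fun_le => //.
  apply: measurable_sum => i; apply: measurable_funX.
  under eq_fun do rewrite mxE.
  apply: measurable_sum => j; exact: measurable_funM.
apply/seteqP; split=> t /=.
  by move=> /spectral_norm_le_rat H [q _]; apply; exact: H.
move=> H; apply/spectral_norm_le_rat => // q.
by apply: contrapT => Hq; apply: H; exists q.
Qed.

End spectral_norm.

(** * From errors on pairs to the difference of Laplacians *)

Section laplacian.
Variables (R : realType) (n : nat).
Implicit Types G H : wgraph R n.

Lemma subr_mxE (A B : 'M[R]_n) i j : (A - B) i j = A i j - B i j.
Proof. by rewrite !mxE. Qed.

Lemma adjacencyC G i j : adjacency G i j = adjacency G j i.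
Proof. by rewrite !mxE finset.setUC. Qed.

Lemma laplacianE G i j :
  laplacian G i j = (\sum_k adjacency G i k) *+ (i == j) - adjacency G i j.
Proof. by rewrite !mxE; case: eqP => [->|_]; rewrite ?mulr1n ?mulr0n. Qed.

Lemma laplacianC G i j : laplacian G i j = laplacian G j i.
Proof.
rewrite !laplacianE adjacencyC eq_sym; congr (_ - _).
by case: eqP => [->|]; rewrite ?mulr0n.
Qed.

(** A pair containing [i] is [[set i; j]] for at most one [j], and the diagonal entries vanish. *)
Lemma adjacencyB_le G H i :
  \sum_j `|adjacency G i j - adjacency H i j| <=
  \sum_(e : vpair n | i \in val e) `|G e - H e|.
Proof.
have adj j : `|adjacency G i j - adjacency H i j| =
    \sum_(e : vpair n | val e == [set i; j]%SET) `|G e - H e|.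
  rewrite !mxE; case: insubP => [e _ <-|Pij]/=.
    by under eq_bigl do rewrite val_eqE; rewrite big_pred1_eq.
  rewrite subrr normr0 big_pred0// => e; apply/negbTE.
  by apply: contra Pij => /eqP <-; exact: (valP e).
under eq_bigr do rewrite adj big_mkcond/=.
rewrite exchange_big/= [leRHS]big_mkcond/=; apply: ler_sum => e _.
rewrite -big_mkcond/=; case: ifPn => ie; last first.
  rewrite big_pred0// => j; apply/negbTE; apply: contraNneq ie => ->.
  by rewrite !inE eqxx.
rewrite sumr_const -[leRHS]mulr1n ler_wpMn2l//.
apply/card_le1_eqP => j k jP kP.
have /eqP ej : val e == [set i; j]%SET := jP.
have /eqP ek : val e == [set i; k]%SET := kP.
have ij : j != i.
  apply/negP => /eqP ji; have /eqP := valP e.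
  by rewrite ej ji finset.setUid cards1.
have : j \in [set i; k]%SET by rewrite -ek ej !inE eqxx orbT.
by rewrite !inE (negbTE ij) => /eqP.
Qed.

(** The factor 2: in each row the degree difference and the adjacency differences contribute at most
    [r] each. Columns follow by symmetry. *)
Lemma spectral_norm_laplacianB_le G H r : 0 <= r ->
    (forall i, \sum_(e : vpair n | i \in val e) `|G e - H e| <= r) ->
  spectral_norm (laplacian G - laplacian H) <= 2 * r.
Proof.
move=> r0 GHr.
have row_le i : \sum_j `|(laplacian G - laplacian H) i j| <= 2 * r.
  set D := fun j => adjacency G i j - adjacency H i j.
  have DE j : (laplacian G - laplacian H) i j = (\sum_k D k) *+ (i == j) - D j.
    rewrite subr_mxE !laplacianE /D sumrB.
    by case: eqP => _; rewrite ?mulr1n ?mulr0n; ring.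
  apply: (@le_trans _ _ (\sum_j (`|\sum_k D k| *+ (i == j) + `|D j|))).
    apply: ler_sum => j _; rewrite DE; apply: le_trans (ler_normB _ _) _.
    by rewrite lerD2r; case: eqP; rewrite ?mulr1n ?mulr0n ?normr0.
  rewrite big_split/=.
  have -> : \sum_j `|\sum_k D k| *+ (i == j) = `|\sum_k D k|.
    rewrite [LHS](bigD1 i)//= eqxx [X in _ + X]big1 ?addr0// => j ji.
    by rewrite eq_sym (negbTE ji) mulr0n.
  rewrite mulrDl mul1r; apply: lerD.
    by apply: le_trans (ler_norm_sum _ _ _) _; exact: le_trans (adjacencyB_le _ _ _) _.
  exact: le_trans (adjacencyB_le _ _ _) _.
apply: spectral_norm_le_Schur; rewrite ?mulr_ge0// => j.
rewrite (eq_bigr (fun i => `|(laplacian G - laplacian H) j i|))// => i _.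
by rewrite !(subr_mxE (laplacian G)) (laplacianC G) (laplacianC H).
Qed.

Lemma card_vpair : #|{: vpair n}| = 'C(n, 2).
Proof. by rewrite card_sig -(card_ord n) -card_draws cardsE card_ord. Qed.

Lemma card_edges_le G : (#|edges G| <= n * maxdeg G)%N.
Proof.
rewrite -sum1_card.
apply: (@leq_trans (\sum_(e in edges G) \sum_(v : 'I_n | v \in val e) 1)%N).
  apply: leq_sum => e _; rewrite sum1_card.
  by have /eqP := valP e; rewrite cardE => /(congr1 (leq 1)) /= ->.
under eq_bigr do rewrite big_mkcond/=.
rewrite exchange_big/= -[X in (_ <= X * _)%N]card_ord -sum_nat_const.
apply: leq_sum => v _; rewrite -big_mkcondr/= sum1_card.
apply: leq_trans (@leq_bigmax _ (fun v : 'I_n =>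
  #|[set e in edges G | v \in val e]%SET|) v).
by apply: eq_leq; rewrite cardsE; apply: eq_card.
Qed.

End laplacian.

(** * Mass of a symmetric interval under the Laplace law *)

Section laplace.
Variable R : realType.

Lemma continuous_scaled_expR (k c : R) : continuous (fun z : R => k * expR (c * z)).
Proof.
move=> z; apply: cvgM; first exact: cvg_cst.
apply: continuous_comp; last exact: continuous_expR.
by apply: cvgM; [exact: cvg_cst|exact: cvg_id].
Qed.

Lemma integral_scaled_expR (k c x y : R) : x < y ->
  (\int[lebesgue_measure]_(z in `[x, y]) (k * c * expR (c * z))%:E =
   (k * expR (c * y) - k * expR (c * x))%:E)%E.
Proof.
move=> xy; rewrite EFinB.
apply: (@continuous_FTC2 _ _ (fun z => k * expR (c * z))) => //.
- exact/continuous_subspaceT/continuous_scaled_expR.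
- split.
  + by move=> z _; exact: ex_derive.
  + by apply/cvg_at_right_filter; exact: continuous_scaled_expR.
  + by apply/cvg_at_left_filter; exact: continuous_scaled_expR.
- move=> z _; rewrite derive1E; apply: (@derive_val _ _ _ _ _ _ _ (is_derive_eq _ _)).
  by rewrite /= /GRing.scale/=; ring.
Qed.

Lemma laplace_pdf_ge0 (b x : R) : 0 < b -> 0 <= laplace_pdf b x.
Proof. by move=> b0; rewrite mulr_ge0 ?expR_ge0// invr_ge0 mulr_ge0// ltW. Qed.

Lemma continuous_laplace_pdf (b : R) : continuous (laplace_pdf b).
Proof.
move=> z; apply: cvgM; first exact: cvg_cst.
apply: continuous_comp; last exact: continuous_expR.
by apply: cvgN; apply: cvgM; [exact: norm_continuous|exact: cvg_cst].
Qed.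

Lemma laplace_prob_itvNc (b t : R) : 0 < b -> 0 < t ->
  laplace_prob b `[- t, t] = (1 - expR (- (t / b)))%:E.
Proof.
move=> b0 t0.
have mpdf : measurable_fun setT (EFin \o laplace_pdf b).
  apply/measurable_EFinP; apply: continuous_measurable_fun.
  exact: continuous_laplace_pdf.
(* Splitting at 0 removes the absolute value, and each half then has an explicit antiderivative. *)
rewrite /laplace_prob (_ : `[- t, t]%classic = `[- t, 0] `|` `]0, t]); last first.
  apply/seteqP; split=> x /=; rewrite !in_itv/=.
    by move=> /andP[-> xt]; case: (leP x 0) => x0; [left|right].
  by move=> [/andP[xt x0]|/andP[x0 xt]]; apply/andP; split; lra.
rewrite ge0_integral_setU//=; last 3 first.
- exact: measurable_funTS.
- by move=> x _; rewrite lee_fin laplace_pdf_ge0.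
- apply/disj_setPS => x [] /=; rewrite !in_itv/= => /andP[_ x0] /andP[]; lra.
rewrite integral_itv_obnd_cbnd; last exact: measurable_funTS.
have -> : (\int[lebesgue_measure]_(x in `[(- t)%R, 0%R]) (laplace_pdf b x)%:E =
    \int[lebesgue_measure]_(x in `[(- t)%R, 0%R]) (2^-1 * b^-1 * expR (b^-1 * x))%:E)%E.
  apply: eq_integral => x; rewrite inE/= in_itv/= => /andP[_ x0].
  by rewrite /laplace_pdf ler0_norm// invfM mulNr opprK mulrC [x / b]mulrC mulrC.
have -> : (\int[lebesgue_measure]_(x in `[0%R, t]) (laplace_pdf b x)%:E =
    \int[lebesgue_measure]_(x in `[0%R, t]) (- 2^-1 * - b^-1 * expR (- b^-1 * x))%:E)%E.
  apply: eq_integral => x; rewrite inE/= in_itv/= => /andP[x0 _].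
  by rewrite /laplace_pdf ger0_norm// invfM mulrNN mulNr [x / b]mulrC.
rewrite !integral_scaled_expR ?oppr_lt0// -EFinD; congr EFin.
have -> : b^-1 * - t = - (t / b) by ring.
have -> : - b^-1 * t = - (t / b) by ring.
by rewrite !mulr0 expR0; field.
Qed.

End laplace.

(** * The sampled set for a given size [k] *)

Section subset_sampling.
Variables (R : realType) (n : nat) (eps : R) (G : wgraph R n).
Let wt := subset_weight eps G.

Definition star (v : 'I_n) : {set vpair n} := [set e : vpair n | v \in val e]%SET.

(** A pair at [v] is determined by its other endpoint; [e0] serves only as the default of
    [insubd]. *)
Lemma card_star_le v : (#|star v| <= n)%N.
Proof.
have [->|[e0 _]] := set_0Vmem (star v); first by rewrite cards0.
rewrite -[leqRHS]card_ord -cardsT.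
apply: leq_trans (leq_imset_card (fun j => insubd e0 [set v; j]%SET) _).
apply: subset_leq_card; apply/fintype.subsetP => e; rewrite inE => ve.
have : #|val e :\ v| == 1%N.
  by have /eqP := valP e; rewrite (cardsD1 v) ve add1n => -[->].
move=> /cards1P[j ej]; apply/imsetP; exists j => //.
by apply: val_inj; rewrite insubdK -?ej ?finset.setD1K// unfold_in; exact: (valP e).
Qed.

Lemma subset_weight_gt0 S : 0 < wt S.
Proof. by apply: prodr_gt0 => e _; exact: expR_gt0. Qed.

Let expG_ge0 (e : vpair n) : 0 <= expR (eps * G e). Proof. exact: expR_ge0. Qed.

Variable k : nat.
Hypothesis kN : (k <= 'C(n, 2))%N.
Let total : R := \sum_(S : {set vpair n} | #|S| == k) wt S.

Let total_gt0 : 0 < total.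
Proof.
have : (0 < #|[set S : {set vpair n} | #|S| == k]%SET|)%N.
  by rewrite card_draws card_vpair bin_gt0.
move=> /card_gt0P[S]; rewrite inE => Sk.
rewrite /total (bigD1 S)//= ltr_pwDl ?subset_weight_gt0//.
by apply: sumr_ge0 => S' _; exact/ltW/subset_weight_gt0.
Qed.

Lemma subset_pmf_ge0 S : 0 <= subset_pmf eps G k S.
Proof.
rewrite /subset_pmf; case: ifP => // _.
by rewrite divr_ge0 ?ltW//; exact: subset_weight_gt0.
Qed.

Let sum_pmfE (Q : pred {set vpair n}) :
  \sum_(S | Q S) subset_pmf eps G k S =
  (\sum_(S : {set vpair n} | (#|S| == k) && Q S) wt S) / total.
Proof.
rewrite mulr_suml [LHS]big_mkcond [RHS]big_mkcond/=; apply: eq_bigr => S _.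
by rewrite /subset_pmf; case: (Q S); case: ifP; rewrite ?andbF.
Qed.

Lemma sum_subset_pmf : \sum_S subset_pmf eps G k S = 1.
Proof. by rewrite sum_pmfE; under eq_bigl do rewrite andbT; rewrite divff ?gt_eqF. Qed.

Lemma notin_edges e : (e \notin edges G) = (G e == 0).
Proof. by rewrite inE negbK. Qed.

(** Non-edges carry the factor [expR 0 = 1], so the exchange bound applies with [E := edges G]. *)
Lemma subset_pmf_avoiding_le e : e \in edges G -> (#|edges G| <= k)%N ->
  \sum_(S : {set vpair n} | e \notin S) subset_pmf eps G k S <=
  'C(n, 2)%:R * expR (- (eps * G e)).
Proof.
move=> eE Ek; rewrite sum_pmfE ler_pdivrMr// expRN mulrAC ler_pdivlMr ?expR_gt0//.
rewrite mulrC -card_vpair; apply: (weight_avoiding_le expG_ge0 (E := edges G)) => //.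
by move=> g; rewrite notin_edges => /eqP ->; rewrite mulr0 expR0.
Qed.

(** Markov's inequality for [2 ^+ #|S :&: A|], with [1 + u <= expR u]. The rate [x / 2] comes from
    [expR 2^-1 <= 2]. *)
Lemma subset_pmf_large_meet_le (A : {set vpair n}) (x : R) :
    A \subset ~: edges G -> (0 < #|~: edges G|)%N ->
  \sum_(S : {set vpair n} | x < #|S :&: A|%:R) subset_pmf eps G k S <=
  expR (#|A|%:R * (k%:R / #|~: edges G|%:R) - x / 2).
Proof.
move=> AE E0; set M := #|~: edges G|.
have e2 : expR 2^-1 <= 2 :> R.
  have := @expR_ge1Dx R (- 2^-1); rewrite expRN => H.
  by rewrite -[leRHS]invrK -lef_pV2 ?posrE ?invr_gt0 ?expR_gt0//; lra.
rewrite expRB ler_pdivlMr ?expR_gt0// mulrC.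
apply: (@le_trans _ _ (expR (x / 2) *
    \sum_(S : {set vpair n} | expR (x / 2) <= 2 ^+ #|S :&: A|) subset_pmf eps G k S)).
  rewrite ler_pM2l ?expR_gt0// big_mkcond [leRHS]big_mkcond/=.
  apply: ler_sum => S _; case: ifPn => [xS|_]; last first.
    by case: ifP => // _; exact: subset_pmf_ge0.
  rewrite ifT//; apply: (@le_trans _ _ (expR (#|S :&: A|%:R * 2^-1))).
    by rewrite ler_expR ler_pM2r ?invr_gt0// ltW.
  by rewrite expRM_natl lerXn2r ?nnegrE ?expR_ge0.
rewrite sum_pmfE mulrA ler_pdivrMr//.
have expGU : {in ~: edges G &, forall f g, expR (eps * G f) = expR (eps * G g)}.
  by move=> f g; rewrite !inE !negbK => /eqP -> /eqP ->.
have := weight_large_meet_le expG_ge0 k expGU (expR (x / 2)) AE E0.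
move=> /le_trans; apply.
apply: ler_wpM2r; first exact/ltW/total_gt0.
by rewrite expRM_natl lerXn2r ?nnegrE ?expR_ge0 ?expR_ge1Dx.
Qed.

(** The part of the good event that concerns the sampled set alone; together with small Laplace
    noise it bounds the error deterministically. *)
Definition typical (t D : R) (S : {set vpair n}) : bool :=
  [forall e in edges G, (e \notin S) ==> (G e <= t)] &&
  [forall v, #|S :&: (star v :\: edges G)|%:R <= D].

(** Union bound. One factor ['C(n, 2)] comes from the exchange bound and one from the number of
    pairs; the outer [n%:R] counts vertices and the one in the exponent bounds a star. *)
Lemma subset_pmf_typical_ge (t D : R) : 0 < eps ->
    (#|edges G| <= k)%N -> (0 < #|~: edges G|)%N ->
  1 - 'C(n, 2)%:R ^+ 2 * expR (- (eps * t))
    - n%:R * expR (n%:R * (k%:R / #|~: edges G|%:R) - D / 2) <=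
  \sum_(S | typical t D S) subset_pmf eps G k S.
Proof.
move=> eps0 Ek E0.
rewrite -addrA -opprD lerBlDr -[leLHS]sum_subset_pmf.
rewrite [leLHS](bigID (typical t D))/= lerD2l.
pose q S := subset_pmf eps G k S.
have q0 S : 0 <= q S by exact: subset_pmf_ge0.
apply: (@le_trans _ _
    (\sum_(e in edges G | t < G e) \sum_(S : {set vpair n} | e \notin S) q S +
     \sum_(v : 'I_n) \sum_(S : {set vpair n} |
        D < #|S :&: (star v :\: edges G)|%:R) q S)).
  under [X in _ <= X + _]eq_bigr do rewrite big_mkcond/=.
  under [X in _ <= _ + X]eq_bigr do rewrite big_mkcond/=.
  rewrite exchange_big [X in _ <= _ + X]exchange_big -big_split/=.
  rewrite big_mkcond/=; apply: ler_sum => S _.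
  have s1 : 0 <= \sum_(e in edges G | t < G e) if e \notin S then q S else 0.
    by apply: sumr_ge0 => e _; case: ifP.
  have s2 : 0 <= \sum_(v : 'I_n) if D < #|S :&: (star v :\: edges G)|%:R
      then q S else 0.
    by apply: sumr_ge0 => e _; case: ifP.
  case: ifPn => [|_]; last exact: addr_ge0.
  rewrite negb_and => /orP[/forallPn[e]|/forallPn[v]].
    rewrite negb_imply negb_imply => /and3P[eE eS]; rewrite -ltNge => tG.
    rewrite -[leLHS]addr0 lerD// (bigD1 e)/= ?eE// eS lerDl.
    by apply: sumr_ge0 => e' _; case: ifP.
  rewrite -ltNge => Dv; rewrite -[leLHS]add0r lerD// (bigD1 v)//= Dv lerDl.
  by apply: sumr_ge0 => v' _; case: ifP.
apply: lerD.
  apply: (@le_trans _ _ (\sum_(e : vpair n) 'C(n, 2)%:R * expR (- (eps * t)))).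
    rewrite big_mkcond/=; apply: ler_sum => e _; case: ifPn => [/andP[eE tG]|_].
      apply: le_trans (subset_pmf_avoiding_le eE Ek) _.
      by rewrite ler_wpM2l// ler_expR lerN2 ler_pM2l// ltW.
    by rewrite mulr_ge0// expR_ge0.
  by rewrite sumr_const card_vpair -[leLHS]mulr_natl mulrA expr2.
rewrite -{1}[n in leRHS]card_ord -sum1_card natr_sum mulr_suml.
apply: ler_sum => v _; rewrite mul1r.
apply: le_trans (subset_pmf_large_meet_le _ _ E0) _.
  by apply/fintype.subsetP => e; rewrite !inE => /andP[].
rewrite ler_expR lerD2r ler_wpM2r ?divr_ge0// ler_nat.
apply: leq_trans (card_star_le v); apply: subset_leq_card.
by apply/fintype.subsetP => e; rewrite !inE => /andP[].
Qed.

End subset_sampling.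

(** * Range of [mhat] and the error on the good event *)

Section algorithm.
Variables (R : realType) (n : nat) (eps beta : R) (G : wgraph R n).

Lemma mhat_le (z : R) (j : int) :
  (mhat eps beta G z <= j) =
  (('C(n, 2)%:Z <= j) || (z <= j%:~R - #|edges G|%:R - ln (1 / beta) / eps)).
Proof.
rewrite /mhat ge_min; congr (_ || _); rewrite ceil_le_int.
by apply/idP/idP; lra.
Qed.

(** A level set of an integer-valued function is a difference of consecutive sublevel sets; here
    each is a half-line or the whole line. *)
Lemma measurable_mhat (j : int) : measurable [set z : R | mhat eps beta G z = j].
Proof.
have mle i : measurable [set z : R | mhat eps beta G z <= i].
  under eq_fun do rewrite mhat_le.
  case: (_ <= i)%R; first by rewrite [X in measurable X](_ : _ = setT)//; apply/seteqP.
  set x : R := _ - _; have -> : [set z | false || (z <= x)] = `]-oo, x]%classic.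
    by apply/seteqP; split=> z /=; rewrite in_itv.
  exact: measurable_itv.
rewrite [X in measurable X](_ : _ = [set z | mhat eps beta G z <= j] `\`
    [set z | mhat eps beta G z <= j - 1]); first exact: measurableD.
by apply/seteqP; split=> z /=; lia.
Qed.

(** The shift by [l] in [mhat] compensates noise down to [- l], whence the lower bound; the final
    [1] pays for the ceiling. *)
Lemma mhat_range (z l : R) : l = ln (1 / beta) / eps -> `|z| <= l ->
  exists k : nat, [/\ mhat eps beta G z = k%:Z, (#|edges G| <= k)%N,
    (k <= 'C(n, 2))%N & k%:R <= #|edges G|%:R + 2 * l + 1].
Proof.
move=> lE; rewrite ler_norml => /andP[lz zl].
have mN : (#|edges G| <= 'C(n, 2))%N.
  by rewrite -(card_vpair n); exact: max_card.
have ge_m : #|edges G|%:Z <= mhat eps beta G z.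
  rewrite /mhat le_min lez_nat mN/= -(@ler_int R).
  by apply: le_trans (ceil_ge _); rewrite -lE; lra.
have le_N : mhat eps beta G z <= 'C(n, 2)%:Z by rewrite /mhat ge_min lexx.
have le_c : (mhat eps beta G z)%:~R <= #|edges G|%:R + 2 * l + 1 :> R.
  apply: (@le_trans _ _ (Num.ceil (#|edges G|%:R + z + ln (1 / beta) / eps))%:~R).
    by rewrite ler_int /mhat ge_min lexx orbT.
  have := ceilB1_lt (#|edges G|%:R + z + ln (1 / beta) / eps).
  rewrite intrB -lE; lra.
case: (mhat eps beta G z) ge_m le_N le_c => // k; rewrite !lez_nat => *.
by exists k.
Qed.

Section output.
Variables (d : measure_display) (T : measurableType d) (P : probability T R).
Variable X : run eps beta G P.

Lemma output_error_le (t : T) (s D : R) : 0 <= s -> 0 <= D ->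
    typical G s D (Ehat X t) -> (forall e, e \in Ehat X t -> `|Z X e t| <= s) ->
  spectral_norm (laplacian G - laplacian (output X t)) <=
  2 * (s * ((maxdeg G)%:R + D)).
Proof.
move=> s0 D0 /andP[/forall_inP miss /forallP deg] Zs.
apply: spectral_norm_laplacianB_le; first by rewrite mulr_ge0// addr_ge0.
move=> i; set S := Ehat X t.
(* Truncation at 0 does not increase the error of a sampled edge, since true weights are
   non-negative. A missed edge loses its whole weight, at most [s] by typicality. *)
have err e : `|G e - what X t e| <=
    (if e \in edges G then s else 0) + (if e \in S :\: edges G then s else 0).
  have := weight_ge0 G e; rewrite /what finset.in_setD.
  have [eE|] /= := boolP (e \in edges G); last first.
    rewrite notin_edges => /eqP -> _; case: ifPn => [eS|_].
      rewrite !add0r normrN ger0_norm ?le_max ?lexx// ge_max s0/=.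
      exact: le_trans (ler_norm _) (Zs _ eS).
    by rewrite subrr normr0 addr0.
  move=> G0; rewrite addr0; case: ifPn => [eS|eS]; last first.
    by rewrite subr0 ger0_norm//; exact: (implyP (miss _ eE)).
  have /ler_normlP[Z1 Z2] := Zs _ eS.
  by rewrite ler_norml; case: (leP 0 (G e + Z X e t)) => ?; apply/andP; split; lra.
apply: le_trans (ler_sum _ (fun e _ => err e)) _.
rewrite big_split/= -!big_mkcondr/= !sumr_const mulrDr; apply: lerD.
  rewrite -[leLHS]mulr_natr ler_wpM2l// ler_nat.
  apply: leq_trans (@leq_bigmax _ (fun v : 'I_n =>
    #|[set e in edges G | v \in val e]%SET|) i).
  apply: subset_leq_card; apply/fintype.subsetP => e /andP[ie eE].
  by rewrite finset.inE eE.
rewrite -[leLHS]mulr_natr ler_wpM2l//; apply: le_trans (deg i).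
rewrite ler_nat; apply: subset_leq_card.
apply/fintype.subsetP => e /andP[ie]; rewrite finset.in_setD => /andP[eE eS].
by rewrite finset.in_setI finset.in_setD eS eE finset.inE.
Qed.

Lemma measurable_output_error (r : R) : 0 <= r -> measurable
  [set t | spectral_norm (laplacian G - laplacian (output X t)) <= r].
Proof.
move=> r0.
have mwhat e : measurable_fun setT (fun t => what X t e).
  rewrite /what; apply: measurable_fun_ifT => //.
    apply: (measurable_fun_bool true); rewrite setTI.
    rewrite (_ : _ @^-1` _ = \bigcup_(S in [set S : {set vpair n} | e \in S])
      (Ehat X @^-1` [set S])).
      apply: fin_bigcup_measurable => [|S _]; last exact: Ehat_measurable.
      exact: finite_finset.
    apply/seteqP; split=> t /=; first by exists (Ehat X t).
    by move=> [S /= eS ->].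
  apply: measurable_maxr => //; apply: measurable_funD => //.
have madj i j : measurable_fun setT (fun t => adjacency (output X t) i j).
  under eq_fun do rewrite mxE.
  case: insub => [e|]; last exact: measurable_cst. exact (mwhat e).
apply: measurable_spectral_norm_le => // i j.
under eq_fun do rewrite subr_mxE !laplacianE.
apply: measurable_funB => //; apply: measurable_funB => //.
case: (i == j).
  by under eq_fun do rewrite mulr1n; exact: measurable_sum.
by under eq_fun do rewrite mulr0n; exact: measurable_cst.
Qed.

End output.
End algorithm.

(** * Probability of the good event of a run *)

Section probability.
Context (R : realType) (d : measure_display) (T : measurableType d)
  (P : probability T R).

Lemma measure_bigcup_finType (I : finType) (Q : pred I) (F : I -> set T) :
    (forall i, measurable (F i)) ->
    (forall i j t, F i t -> F j t -> i = j) ->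
  P (\bigcup_(i in [set` Q]) F i) = (\sum_(i | Q i) P (F i))%E.
Proof.
move=> mF dF; rewrite measure_fin_bigcup//; last by move=> i j _ _ [t []]; exact: dF.
rewrite -(@bigfs _ _ _ _ (index_enum I) Q)//; first exact: index_enum_uniq.
by move=> i _; rewrite mem_index_enum.
Qed.

Lemma bernoulli_inequality (x : R) (j : nat) : 0 <= x <= 1 ->
  1 - j%:R * x <= (1 - x) ^+ j.
Proof.
move=> /andP[x0 x1]; elim: j => [|j IH]; first by rewrite mul0r subr0 expr0.
rewrite exprS; apply: (@le_trans _ _ ((1 - x) * (1 - j%:R * x))).
  have : 0 <= j%:R * x ^+ 2 by rewrite mulr_ge0 ?sqr_ge0.
  by rewrite -natr1; nra.
by rewrite ler_wpM2l// subr_ge0.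
Qed.

Variables (n : nat) (eps beta : R) (G : wgraph R n) (X : run eps beta G P).
Variables (Q : nat -> pred {set vpair n}) (l s eta delta : R).
Hypothesis eps_gt0 : 0 < eps.
Hypothesis l_gt0 : 0 < l.
Hypothesis s_gt0 : 0 < s.
Hypothesis mhatQ : forall z : R, `|z| <= l -> exists k : nat,
  [/\ mhat eps beta G z = k%:Z, (k <= 'C(n, 2))%N &
      1 - eta <= \sum_(S | Q k S) subset_pmf eps G k S].
Hypothesis delta_ge : 'C(n, 2)%:R * expR (- (eps * s)) <= delta.
Hypothesis delta_le1 : delta <= 1.

Definition run_event : set T := [set t | [/\ `|Z0 X t| <= l,
  exists2 k : nat, mhat eps beta G (Z0 X t) = k%:Z & Q k (Ehat X t) &
  forall e, e \in Ehat X t -> `|Z X e t| <= s]].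

Let N := 'C(n, 2).
Let itv (x : R) : set R := `[- x, x]%classic.
(** [run_law] gives probabilities only for a prescribed size and set, so the good event is cut into
    finitely many such pieces; by [mhatQ] the sizes up to [N] suffice. *)
Let atom (i : 'I_N.+1 * {set vpair n}) : set T :=
  [set t | [/\ itv l (Z0 X t), mhat eps beta G (Z0 X t) = i.1%:Z,
     Ehat X t = i.2 & forall e, e \in i.2 -> itv s (Z X e t)]].
Let size_atom (k : 'I_N.+1) : set T :=
  Z0 X @^-1` (itv l `&` [set z | mhat eps beta G z = k%:Z]).

Let mitv x : measurable (itv x). Proof. exact: measurable_itv. Qed.

Let msize_atom k : measurable (size_atom k).
Proof. by apply: measurable_funPTI; apply: measurableI => //; exact: measurable_mhat. Qed.

Let itvE x y : itv x y <-> `|y| <= x.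
Proof. by rewrite /itv /= in_itv/= ler_norml. Qed.

Let matom i : measurable (atom i).
Proof.
have -> : atom i = size_atom i.1 `&` (Ehat X @^-1` [set i.2]) `&`
    \bigcap_(e in [set` i.2]) (Z X e @^-1` itv s).
  apply/seteqP; split=> t /=; first by move=> [].
  by move=> [[[? ?] ?] H]; split.
apply: measurableI; first by apply: measurableI => //; exact: Ehat_measurable.
apply: fin_bigcap_measurable => [|e _]; first exact: finite_finset.
exact: measurable_funPTI.
Qed.

Let run_eventE : run_event =
  \bigcup_(i in [set` fun i : 'I_N.+1 * {set vpair n} => Q i.1 i.2]) atom i.
Proof.
apply/seteqP; split=> t /=.
  move=> [Z0l [k mk QE] ZE]; have [k' [mk' k'N _]] := mhatQ Z0l.
  have {mk'} kk' : k = k' by move: mk'; rewrite mk => -[].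
  have kN : (k < N.+1)%N by rewrite ltnS kk'.
  exists (Ordinal kN, Ehat X t) => //; split => //; first exact/itvE.
  by move=> e /ZE /itvE.
move=> [[k S] /= QS [/itvE Z0l mk ES ZE]]; split => //.
  by exists k => //; rewrite ES.
by move=> e; rewrite ES => /ZE/itvE.
Qed.

Lemma measurable_run_event : measurable run_event.
Proof. by rewrite run_eventE; apply: fin_bigcup_measurable. Qed.

Let p : R := 1 - expR (- (eps * s)).

Let laplace_itv x : 0 < x ->
  laplace_prob (1 / eps) (itv x) = (1 - expR (- (eps * x)))%:E.
Proof.
by move=> x0; rewrite laplace_prob_itvNc ?divr_gt0// div1r invrK mulrC.
Qed.

Let lambda k : R := fine (P (size_atom k)).

Let lambdaE k : (lambda k)%:E = P (size_atom k).
Proof. by rewrite fineK// fin_num_measure. Qed.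

Let lambda_ge0 k : 0 <= lambda k.
Proof. by rewrite fine_ge0. Qed.

Let prob_atom i : P (atom i) =
  (lambda i.1 * subset_pmf eps G i.1 i.2 * p ^+ #|i.2|)%:E.
Proof.
rewrite (run_law X i.1 i.2 (mitv l) (fun=> mitv s)).
rewrite !EFinM lambdaE -(Z0_law X); last first.
  by apply: measurableI => //; exact: measurable_mhat.
congr (_ * _)%E; under eq_bigr do rewrite laplace_itv//.
by rewrite -/p -prodr_const (big_morph EFin EFinM (erefl 1%:E)).
Qed.

(** By [mhatQ], the size atoms partition the event that [Z0] lies in [itv l]. *)
Let sum_lambda : \sum_k lambda k = 1 - expR (- (eps * l)).
Proof.
apply: EFin_inj; rewrite -laplace_itv// -(Z0_law X)// -sumEFin.
rewrite (eq_bigr (fun k => P (size_atom k))) => [|k _]; last exact: lambdaE.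
rewrite -(@measure_bigcup_finType _ xpredT)//; last first.
  move=> i j t [_ /= mi] [_ /= mj]; apply: val_inj => /=.
  by move: mj; rewrite mi => -[].
congr (P _); apply/seteqP; split=> t /=; first by move=> [k _ []].
move=> tl; have [k [mk kN _]] := mhatQ (iffLR (itvE _ _) tl).
by have kN' : (k < N.+1)%N by []; exists (Ordinal kN').
Qed.

Lemma run_event_prob_ge :
  (((1 - expR (- (eps * l))) * (1 - eta) * (1 - delta))%:E <= P run_event)%E.
Proof.
rewrite run_eventE measure_bigcup_finType//; last first.
  move=> [k S] [k' S'] t [/= _ mk ES _] [/= _ mk' ES' _].
  congr (_, _); last by rewrite -ES.
  by apply: val_inj => /=; move: mk'; rewrite mk => -[].
under eq_bigr do rewrite prob_atom.
rewrite sumEFin lee_fin -sum_lambda -mulrA mulr_suml.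
rewrite -(pair_big_dep xpredT (fun (k : 'I_N.+1) S => Q k S) (fun (k : 'I_N.+1) S =>
  lambda k * subset_pmf eps G k S * p ^+ #|S|))/=.
apply: ler_sum => k _.
(* [mhatQ] speaks only of sizes attained with noise at most [l]; any other size has an empty atom
   and contributes 0. *)
have [[t [/itvE Z0l mk]]|k0] := pselect (exists t, size_atom k t); last first.
  suff -> : lambda k = 0 by rewrite mul0r big1// => S _; rewrite !mul0r.
  rewrite /lambda (_ : size_atom k = set0) ?measure0//.
  by apply/seteqP; split=> t //= kt; case: k0; exists t.
have [k' [mk' kN eta_le]] := mhatQ Z0l.
have kk' : k' = k by move: mk'; rewrite mk => -[].
rewrite {}kk' in kN eta_le.
under [leRHS]eq_bigr do rewrite -mulrA.
rewrite -mulr_sumr ler_wpM2l//.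
apply: (@le_trans _ _ ((\sum_(S | Q k S) subset_pmf eps G k S) * (1 - delta))).
  by rewrite ler_wpM2r// subr_ge0.
rewrite mulr_suml; apply: ler_sum => S _; rewrite ler_wpM2l ?subset_pmf_ge0//.
(* All noises on [S] are small with probability [p ^+ #|S|]; Bernoulli's inequality and
   [#|S| <= 'C(n, 2)] make the bound uniform in [S]. *)
apply: le_trans (bernoulli_inequality _ _); last first.
  by rewrite expR_ge0 -expR0 ler_expR oppr_le0 mulr_ge0// ltW.
rewrite lerD2l lerN2; apply: le_trans delta_ge.
rewrite ler_wpM2r ?expR_ge0// ler_nat -(card_vpair n); exact: max_card.
Qed.

End probability.

(** * Elementary bounds on ['C(n, 2)] *)

Lemma double_bin2 (n : nat) : (2 * 'C(n, 2) = n * n.-1)%N.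
Proof.
have := odd_double_half (n * n.-1); rewrite -bin2 mul2n => <-.
by rewrite oddM; case: n => //= j; case: (odd j).
Qed.

Lemma bin2_le_sqr (n : nat) : ('C(n, 2) <= n ^ 2)%N.
Proof.
apply: (@leq_trans (2 * 'C(n, 2))%N); first exact: leq_pmull.
by rewrite double_bin2 -mulnn leq_mul2l leq_pred orbT.
Qed.

Lemma sqr_le_bin2 (n : nat) : (2 <= n)%N -> (n ^ 2 <= 4 * 'C(n, 2))%N.
Proof.
move=> n2; rewrite -[4%N]/(2 * 2)%N -mulnA double_bin2 mulnCA -mulnn leq_mul2l.
by lia.
Qed.

(** The summands are the prefactors of the three failure probabilities: a missed heavy edge, a
    vertex with too many sampled non-edges, a large noise. *)
Lemma bin2_poly_le (n : nat) : (2 <= n)%N ->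
  ('C(n, 2) ^ 2 + n + 'C(n, 2) <= n ^ 5)%N.
Proof.
move=> n2; have C_le := bin2_le_sqr n.
have C2_le : ('C(n, 2) ^ 2 <= n ^ 4)%N by rewrite (expnM n 2 2) leq_exp2r.
have n4 : (4 * n ^ 2 <= n ^ 4)%N.
  by rewrite (expnD n 2 2) leq_mul2r (leq_exp2r 2 n (isT : 0 < 2)%N) n2 orbT.
have n5 : (2 * n ^ 4 <= n ^ 5)%N by rewrite [(n ^ 5)%N]expnS leq_mul2r n2 orbT.
have nn : (n <= n ^ 2)%N by rewrite -{1}(expn1 n) leq_exp2l.
lia.
Qed.

(** * Choice of parameters and the bound for a fixed [n] *)

Section concentration.
Variables (R : realType) (n : nat) (G : wgraph R n) (c eps beta : R).
Hypothesis c_gt0 : 0 < c.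
Hypothesis eps_gt0 : 0 < eps.
Hypothesis beta_range : 0 < beta < 1 / 2.
Hypothesis ln_ge1 : 1 <= ln n%:R :> R.
Hypothesis edges_gt0 : (0 < #|edges G|)%N.
Hypothesis edges_le : (2 * #|edges G| <= 'C(n, 2))%N.

(** The [5] absorbs the prefactor [n ^ 5] of the union bound and leaves [n] to the power [- c]. *)
Let K : R := c + 5.
Let L : R := ln n%:R.
Let m : R := #|edges G|%:R.
Let l : R := ln (1 / beta) / eps.
Let s : R := K * L / eps.
Let M : R := #|~: edges G|%:R.
(** In the tail bound, [D / 2] cancels the mean term through its first summand and leaves at most
    [expR (- (K * L))] through its second. *)
Let D : R := 2 * (n%:R * ((m + 2 * l + 1) / M) + K * L).

Let n_ge2 : (2 <= n)%N.
Proof.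
rewrite ltnNge; apply/negP => n1.
have n1' : n%:R <= 1 :> R by rewrite lern1.
by have := ln_le0 n1'; have := ln_ge1; lra.
Qed.

Let L_gt0 : 0 < L. Proof. exact: lt_le_trans ln_ge1. Qed.
Let K_gt0 : 0 < K. Proof. exact: addr_gt0. Qed.
Let l_gt0 : 0 < l.
Proof.
rewrite divr_gt0// ln_gt0//; have /andP[b0 b1] := beta_range.
by rewrite ltr_pdivlMr// mul1r; lra.
Qed.
Let s_gt0 : 0 < s. Proof. by rewrite divr_gt0// mulr_gt0. Qed.
Let n_gt0 : 0 < n%:R :> R. Proof. by rewrite ltr0n ltnW. Qed.

Let card_compl : (#|~: edges G| + #|edges G| = 'C(n, 2))%N.
Proof. by rewrite addnC cardsC card_vpair. Qed.

Let M_ge : n%:R ^+ 2 <= 8 * M.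
Proof.
rewrite -natrX -natrM ler_nat; apply: leq_trans (sqr_le_bin2 n_ge2) _.
by move: card_compl edges_le => <-; move: #|~: _| #|edges _| => a b; lia.
Qed.

Let M_gt0 : 0 < M.
Proof. have := exprn_gt0 2 n_gt0; have := M_ge; lra. Qed.

Let D_ge0 : 0 <= D.
Proof.
have m0 : 0 <= m by [].
have A : 0 <= n%:R * ((m + 2 * l + 1) / M).
  by rewrite mulr_ge0// divr_ge0 ?ltW//; have := l_gt0; lra.
have B : 0 < K * L by rewrite mulr_gt0.
by rewrite /D; lra.
Qed.

Let maxdeg_ge1 : 1 <= (maxdeg G)%:R :> R.
Proof.
rewrite ler1n lt0n; apply/negP => /eqP D0.
by have := card_edges_le G; rewrite D0 muln0 leqNgt edges_gt0.
Qed.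

(** With [x] and [y] as below, [D] is at most [32 * x + 32 * y + 2 * K * L]. Adding [x] gives the
    33, and [1 <= L] and [1 <= x] absorb every term into [x * L + y * L]. *)
Let error_le : 2 * (s * ((maxdeg G)%:R + D)) <=
  2 * K * (33 + 2 * K) * ((maxdeg G)%:R * L ^+ 2 / eps +
                          ln (1 / beta) * L ^+ 2 / (n%:R * eps ^+ 2)).
Proof.
set x : R := (maxdeg G)%:R; pose y : R := l / n%:R.
have y0 : 0 <= y by rewrite divr_ge0 ?ltW.
have x1 : 1 <= x := maxdeg_ge1.
have m_le : m <= n%:R * x by rewrite /m/x -natrM ler_nat card_edges_le.
have n1 : 1 <= n%:R :> R by rewrite ler1n ltnW.
(* Since [m] and [1] are at most [n%:R * x], the numerator is at most [(2 * x + 2 * y) * n%:R];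
   [M_ge] contributes the remaining factor 8. *)
have avg_le : n%:R * ((m + 2 * l + 1) / M) <= 16 * x + 16 * y.
  rewrite mulrA ler_pdivrMr//.
  apply: (@le_trans _ _ ((2 * x + 2 * y) * n%:R ^+ 2)); last first.
    have -> : (16 * x + 16 * y) * M = (2 * x + 2 * y) * (8 * M) by ring.
    by rewrite ler_wpM2l ?M_ge//; lra.
  have lE : l = y * n%:R by rewrite /y divfK ?gt_eqF.
  rewrite expr2 mulrA [leLHS]mulrC ler_wpM2r// lE.
  by nra.
have -> : ln (1 / beta) * L ^+ 2 / (n%:R * eps ^+ 2) = y * L ^+ 2 / eps.
  by rewrite /y /l; field; rewrite !gt_eqF.
have -> : 2 * K * (33 + 2 * K) * (x * L ^+ 2 / eps + y * L ^+ 2 / eps) =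
    2 * (s * ((33 + 2 * K) * (x * L + y * L))) by rewrite /s; field; rewrite gt_eqF.
rewrite ler_pM2l// ler_pM2l//.
have L1 : 1 <= L by [].
have xL : x <= x * L by rewrite ler_peMr//; lra.
have Lx : L <= x * L by rewrite ler_peMl// ltW.
have yL : y <= y * L by rewrite ler_peMr.
have KL : K * L <= K * (x * L) by rewrite ler_pM2l.
have KyL : 0 <= K * (y * L) := mulr_ge0 (ltW K_gt0) (mulr_ge0 y0 (ltW L_gt0)).
rewrite /D; lra.
Qed.

Let tail_le : ('C(n, 2)%:R ^+ 2 + n%:R + 'C(n, 2)%:R) * expR (- (K * L)) <=
  1 / n%:R `^ c.
Proof.
have n5E : n%:R ^+ 5 * expR (- (K * L)) = 1 / n%:R `^ c.
  rewrite /powR gt_eqF// -/L -[in LHS](@lnK _ n%:R) ?posrE// -/L -expRM_natl.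
  by rewrite -expRD div1r -expRN; congr expR; rewrite /K; ring.
rewrite -n5E ler_wpM2r ?expR_ge0// -!natrX -!natrD ler_nat.
exact: bin2_poly_le.
Qed.

Lemma output_error_prob (d : measure_display) (T : measurableType d)
    (P : probability T R) (X : run eps beta G P) :
  ((1 - 2 * beta - 1 / n%:R `^ c)%:E <=
   P [set t | (spectral_norm (laplacian G - laplacian (output X t)) <=
     2 * K * (33 + 2 * K) * ((maxdeg G)%:R * L ^+ 2 / eps +
       ln (1 / beta) * L ^+ 2 / (n%:R * eps ^+ 2)))%R])%E.
Proof.
have /andP[b0 b1] := beta_range.
set bound : R := 2 * K * _ * _.
have bound_ge0 : 0 <= bound.
  by apply: le_trans error_le; rewrite mulr_ge0// mulr_ge0 ?addr_ge0// ltW.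
have sE : eps * s = K * L by rewrite /s mulrCA divff ?gt_eqF// mulr1.
pose q := expR (- (K * L)).
have q0 : 0 <= q by exact: expR_ge0.
pose eta := 'C(n, 2)%:R ^+ 2 * q + n%:R * q.
pose delta := 'C(n, 2)%:R * q.
have sum_le : eta + delta <= 1 / n%:R `^ c.
  by apply: le_trans tail_le; rewrite /eta /delta -/q -!mulrDl.
have eta0 : 0 <= eta by rewrite addr_ge0// mulr_ge0// sqr_ge0.
have delta0 : 0 <= delta by rewrite mulr_ge0.
have powR_ge1 : 1 / n%:R `^ c <= 1.
  rewrite div1r invf_le1 ?powR_gt0//.
  by rewrite /powR gt_eqF// -[leLHS]expR0 ler_expR mulr_ge0 ?(ltW c_gt0) ?(ltW L_gt0).
have delta1 : delta <= 1 by lra.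
have mhatQ (z : R) : `|z| <= l -> exists k : nat,
  [/\ mhat eps beta G z = k%:Z, (k <= 'C(n, 2))%N &
      1 - eta <= \sum_(S | typical G s D S) subset_pmf eps G k S].
  move=> /(mhat_range G erefl)[k [mk Ek kN k_le]]; exists k; split => //.
  have M0 : (0 < #|~: edges G|)%N by rewrite -(ltr0n R).
  apply: le_trans (subset_pmf_typical_ge kN s D eps_gt0 Ek M0).
  rewrite /eta opprD addrA sE lerD2l lerN2 ler_wpM2l// ler_expR -/M /D.
  have : n%:R * (k%:R / M) <= n%:R * ((m + 2 * l + 1) / M).
    by rewrite ler_pM2l// ler_pM2r ?invr_gt0.
  lra.
have delta_ge : 'C(n, 2)%:R * expR (- (eps * s)) <= delta by rewrite sE.
(* [l] is the level that [Z0] exceeds in absolute value with probability exactly [beta]. *)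
have expl : expR (- (eps * l)) = beta.
  rewrite /l mulrCA divff ?gt_eqF// mulr1 expRN lnK ?posrE ?divr_gt0//.
  by rewrite div1r invrK.
apply: (@le_trans _ _ (P (run_event X (fun=> typical G s D) l s))).
  have := run_event_prob_ge X eps_gt0 l_gt0 s_gt0 mhatQ delta_ge delta1.
  apply: le_trans; rewrite lee_fin expl.
  (* The product is at least [1 - beta - eta - delta], and [sum_le] bounds [eta + delta]. *)
  have := mulr_ge0 (ltW b0) eta0; have := mulr_ge0 (ltW b0) delta0.
  have := mulr_ge0 eta0 delta0; nra.
apply: le_measure; rewrite ?inE.
- exact: measurable_run_event mhatQ.
- exact: measurable_output_error.
- move=> t [_ [k _ typ] Zs] /=; apply: le_trans error_le.
  by apply: output_error_le => //; exact: ltW.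
Qed.

End concentration.

(** * Passage to large [n] *)

Theorem theorem4p2 (R : realType) (G : forall n : nat, wgraph R n)
    (maxdeg_le : forall n : nat, (maxdeg (G n) <= n.-1)%N)
    (m_Omega : (fun n : nat => #|edges (G n)|%:R : R) =Omega_\oo
               (fun n : nat => n%:R : R))
    (m_o : (fun n : nat => #|edges (G n)|%:R : R) =o_\oo
           (fun n : nat => 'C(n, 2)%:R : R))
    (c : R) (c_gt0 : 0 < c) :
  exists2 C : R, 0 < C &
    \forall n \near \oo,
    forall eps beta : R, 0 < eps -> 0 < beta < 1 / 2 ->
    forall (d : measure_display) (T : measurableType d) (P : probability T R)
      (X : run eps beta (G n) P),
    ((1 - 2 * beta - 1 / (n%:R `^ c))%:E <=
     P [set t | (spectral_norm (laplacian (G n) - laplacian (output X t)) <=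
          C * ((maxdeg (G n))%:R * ln n%:R ^+ 2 / eps +
               ln (1 / beta) * ln n%:R ^+ 2 / (n%:R * eps ^+ 2)))%R])%E.
Proof.
(* The constant depends on [c] alone, and the threshold for [n] is fixed before [eps], [beta] and
   the probability space. *)
exists (2 * (c + 5) * (33 + 2 * (c + 5))); first by nra.
(* A positive edge count makes the maximal degree at least 1, which [error_le] uses to absorb the
   terms free of the degree. *)
have [k k0 m_ge] : exists2 k : R, 0 < k & \forall n \near \oo,
    k * n%:R <= #|edges (G n)|%:R.
  move: m_Omega; rewrite eqOmegaE => /asboolP[k k0 H]; exists k => //.
  by apply: filterS H => n; rewrite !normr_nat.
have m_le : \forall n \near \oo, #|edges (G n)|%:R <= 2^-1 * 'C(n, 2)%:R :> R.
  have half_gt0 : 0 < 2^-1 :> R by rewrite invr_gt0.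
  move: m_o => /eqoP /(_ _ half_gt0).
  by apply: filterS => n; rewrite !normr_nat.
near=> n => eps beta eps0 beta_range d T P X.
have n_ge : expR 1 <= n%:R :> R by near: n; exact: nbhs_infty_ger.
have n0 : 0 < n%:R :> R by exact: lt_le_trans (expR_gt0 _) n_ge.
apply: output_error_prob => //.
- by rewrite -[leLHS]expRK ler_ln ?posrE ?expR_gt0.
- rewrite -(ltr0n R); apply: (@lt_le_trans _ _ (k * n%:R)); first exact: mulr_gt0.
  by near: n.
- have : #|edges (G n)|%:R <= 2^-1 * 'C(n, 2)%:R :> R by near: n.
  by rewrite ler_pdivlMl// -natrM ler_nat.
Unshelve. all: by end_near. Qed.
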